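(* Let $r\geq 2$ and let $p_1\ge p_2\ge \dots \ge p_r\geq 2$ be integers. Then $$R^{PM}(p_1, \dots, p_r)\leq \left\lceil p_1-\frac{r}{3}+\sum_{i=2}^r\frac{p_i}{3}\right\rceil.$$
   Context: A path-matching is a vertex-disjoint union of paths, each with at least 2 vertices; its order is the number of vertices it spans. An $r$-coloring of $K_n$ is an assignment of a color from $[r]=\{1,\dots,r\}$ to each edge of the complete graph $K_n$ (not necessarily proper, and not every color need be used). A path-matching of color $i$ is a path-matching that is a subgraph of $K_n$ all of whose edges have color $i$. For positive integers $r,p_1,\dots,p_r$, $R^{PM}(p_1,\dots,p_r)$ is the smallest positive integer $n$ such that in every $r$-coloring of the edges of $K_n$ there exists a path-matching of color $i$ and order at least $p_i$ for some $i\in[r]$. *)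

(* Defs.v *)
From mathcomp Require Import all_boot all_order all_algebra.
From mathcomp Require Import boolp.

Set Implicit Arguments.
Unset Strict Implicit.
Unset Printing Implicit Defensive.

(* A path-matching is given by the list of its paths, each path by the list of
   its vertices in order. *)
Definition path_matching (T : finType) (e : rel T) (P : seq (seq T)) : bool :=
  [&& all (fun s => 1 < size s) P, all (sorted e) P & uniq (flatten P)].

Definition pm_order (T : finType) (P : seq (seq T)) : nat := size (flatten P).

(* An edge of K_n is a two-element set [set x; y]; the values taken outside
   the two-element sets are never used. Colors are numbered from 0. *)
Definition coloring (r n : nat) : Type := {set 'I_n} -> 'I_r.

Definition color_graph (r n : nat) (c : coloring r n) (i : 'I_r) : rel 'I_n :=
  fun x y => (x != y) && (c [set x; y] == i).

Definition PM_unavoidable (r : nat) (p : 'I_r -> nat) (n : nat) : Prop :=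
  forall c : coloring r n, exists (i : 'I_r) (P : seq (seq 'I_n)),
    path_matching (color_graph c i) P /\ p i <= pm_order P.

(* Pigeonhole on the colors of a fixed matching with 1 + \sum_i p i edges. *)
Lemma PM_unavoidable_ex (r : nat) (p : 'I_r -> nat) :
  exists n, `[< 0 < n /\ PM_unavoidable p n >].
Proof.
pose m := (\sum_i p i).+1.
exists #|{: 'I_m * bool}|; apply/asboolP; split.
  by rewrite card_prod card_ord card_bool.
move=> c; pose f (k : 'I_m) (b : bool) := enum_rank (k, b).
have f_inj k k' b b' : f k b = f k' b' -> (k, b) = (k', b').
  exact: enum_rank_inj.
pose col k := c [set f k false; f k true].
have [i le_pi] : exists i, p i <= #|[set k | col k == i]|.
  apply/existsP; apply: contraT; rewrite negb_exists => /forallP lt_p.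
  have: \sum_i #|[set k | col k == i]| <= \sum_i p i.
    by apply: leq_sum => i _; rewrite ltnW // ltnNge lt_p.
  suff ->: \sum_i #|[set k | col k == i]| = m by rewrite ltnn.
  rewrite -[RHS]card_ord -sum1_card (partition_big col predT) //=.
  by apply: eq_bigr => i _; rewrite -sum1_card; apply: eq_bigl => k; rewrite inE.
pose s := enum [set k | col k == i].
pose P := [seq [seq f k b | b <- [:: false; true]] | k <- s].
exists i, P; split.
  apply/and3P; split.
  - by apply/allP => _ /mapP[k _ ->].
  - apply/allP => _ /mapP[k + ->]; rewrite mem_enum inE /= andbT => colk.
    by rewrite /color_graph colk andbT; apply/eqP => /f_inj [].
  - apply: allpairs_uniq; rewrite ?enum_uniq //.
    by move=> [k b] [k' b'] _ _ /f_inj.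
apply: leq_trans le_pi _.
by rewrite /pm_order size_allpairs -cardE leq_pmulr.
Qed.

Definition RPM (r : nat) (p : 'I_r -> nat) : nat := ex_minn (PM_unavoidable_ex p).

(* Main.v *)
(* In a graph [e] take a packing by paths on 2 or 3 vertices of maximum order.
   Let D be the set of vertices left uncovered by some packing obtained from it
   by replacing an end of a 3-vertex path with an uncovered neighbor of its
   middle. By maximality the set S of neighbors of D consists of middles of
   3-vertex paths whose ends lie in D, so the order is at least 3 #|S| plus the
   number of nonisolated vertices of [e - S].
   Applied to every color i, this gives sets S_i and B_i with
   3 #|S_i| + #|B_i| < p_i such that every edge of color i meets S_i or lies in
   B_i. The sets B_i thus cover all pairs of vertices outside the union of the
   S_i, and a count at a vertex lying in the fewest B_i bounds the number of
   these vertices. *)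
Require Import Defs.
From mathcomp Require Import all_boot all_order all_algebra.
From mathcomp Require Import boolp zify lra.
Import Order.TTheory GRing.Theory Num.Theory.

Set Implicit Arguments.
Unset Strict Implicit.
Unset Printing Implicit Defensive.

(** * Packings by paths on two or three vertices *)

Section ShortPathMatching.
Variables (T : finType) (e : rel T).
Hypotheses (e_sym : symmetric e) (e_irr : irreflexive e).

(** Any path on at least two vertices can be cut into paths on 2 or 3 vertices, so the restriction
    costs no order. *)
Definition short_path_matching (P : seq (seq T)) : bool :=
  path_matching e P && all (fun s => size s <= 3) P.

Lemma short_path_matching_perm (P Q : seq (seq T)) :
  perm_eq P Q -> short_path_matching P = short_path_matching Q.
Proof.
move=> PQ; rewrite /short_path_matching /path_matching !(perm_all _ PQ).
by rewrite (perm_uniq (perm_flatten PQ)).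
Qed.

Lemma short_path_matching_cons (s : seq T) (R : seq (seq T)) :
  short_path_matching (s :: R) = [&& 1 < size s <= 3, sorted e s, uniq s,
    all [predC flatten R] s & short_path_matching R].
Proof.
rewrite /short_path_matching /path_matching /= cat_uniq has_sym -all_predC.
rewrite (eq_all (a2 := [predC flatten R])) //.
by case: (1 < _); case: (size _ <= 3); case: (sorted e s); case: (uniq s);
  case: (all _ s); rewrite /= ?andbF ?andbT.
Qed.

Lemma pm_order_perm (P Q : seq (seq T)) :
  perm_eq P Q -> pm_order P = pm_order Q.
Proof. by move=> PQ; rewrite /pm_order (perm_size (perm_flatten PQ)). Qed.

Lemma pm_order_max (P : seq (seq T)) :
  path_matching e P -> pm_order P <= #|T|.
Proof.
by case/and3P=> _ _ uP; rewrite /pm_order -(card_uniqP uP) max_card.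
Qed.

Lemma max_short_path_matching : exists P, short_path_matching P /\
  forall Q, short_path_matching Q -> pm_order Q <= pm_order P.
Proof.
pose ok n := `[< exists P, short_path_matching P /\ pm_order P = n >].
have ok0 : exists n, ok n by exists 0; apply/asboolP; exists [::].
have okb n : ok n -> n <= #|T|.
  by move=> /asboolP[P [/andP[/pm_order_max + _] <-]].
case: (ex_maxnP ok0 okb) => m /asboolP[P [okP <-]] maxP.
by exists P; split=> // Q okQ; apply: maxP; apply/asboolP; exists Q.
Qed.

(** [exchange_swap] is the only real move. Permutation and reversal bring the affected path to the
    head of the list and the end to be replaced to the front of that path. *)
Inductive exchange_reach (P0 : seq (seq T)) : seq (seq T) -> Prop :=
| exchange_refl : exchange_reach P0 P0
| exchange_perm P Q : exchange_reach P0 P -> perm_eq P Q -> exchange_reach P0 Q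
| exchange_rev a w b R : exchange_reach P0 ([:: a; w; b] :: R) ->
    exchange_reach P0 ([:: b; w; a] :: R)
| exchange_swap v a w b R : exchange_reach P0 ([:: a; w; b] :: R) ->
    e v w -> v \notin flatten ([:: a; w; b] :: R) ->
    exchange_reach P0 ([:: v; w; b] :: R).

Lemma short_path_matching_swap (v a w b : T) (R : seq (seq T)) :
  short_path_matching ([:: a; w; b] :: R) -> e v w ->
  v \notin flatten ([:: a; w; b] :: R) ->
  short_path_matching ([:: v; w; b] :: R) /\
  a \notin flatten ([:: v; w; b] :: R).
Proof.
rewrite !short_path_matching_cons /= !inE !negb_or !andbT -!andbA => + -> /=.
case/and5P=> eaw -> aw ab /and5P[-> aR -> -> ->].
case/and4P=> va -> -> ->.
by rewrite eq_sym va aw ab aR.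
Qed.

Lemma exchange_reach_ok (P0 P : seq (seq T)) :
  short_path_matching P0 -> exchange_reach P0 P ->
  short_path_matching P /\ pm_order P = pm_order P0.
Proof.
move=> ok0; elim=> [//|Q Q' _ [okQ ordQ] QQ'|a w b R _ [okR ordR]|].
- by rewrite -(short_path_matching_perm QQ') -(pm_order_perm QQ').
- split; last exact: ordR.
  move: okR; rewrite !short_path_matching_cons /= !inE !negb_or !andbT -!andbA.
  case/and5P=> eaw ewb aw ab /and5P[wb aR wR bR okR].
  rewrite (e_sym b) ewb (e_sym w) eaw !(eq_sym b) (eq_sym w a).
  by rewrite aw ab wb aR wR bR.
- move=> v a w b R _ [okR ordR] evw vR.
  by have [okR' _] := short_path_matching_swap okR evw vR.
Qed.

(** In every other position of [w] the order could grow: an uncovered [w] gives the new path [v w],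
    an end of a 2-vertex path extends it by [v], and an end of a 3-vertex path pairs with [v],
    leaving the other two vertices as an edge. *)
Lemma uncovered_neighbor (P : seq (seq T)) (v w : T) :
  short_path_matching P ->
  (forall Q, short_path_matching Q -> pm_order Q <= pm_order P) ->
  v \notin flatten P -> e v w ->
  exists a b, [:: a; w; b] \in P.
Proof.
move=> okP maxP vP evw.
have ewv : e w v by rewrite e_sym.
have vw : v != w by apply: contraTneq evw => ->; rewrite e_irr.
have wv : w != v by rewrite eq_sym.
have [wP|wP] := boolP (w \in flatten P); last first.
  have /maxP : short_path_matching ([:: v; w] :: P).
    by rewrite short_path_matching_cons /= evw inE vw vP wP okP.
  by rewrite /pm_order /= leqNgt ltnS leqnSn.
have /flattenP[s sP ws] := wP.
have PR := perm_to_rem sP; set R := rem s P in PR.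
have ordP := pm_order_perm PR.
have okR := okP; rewrite (short_path_matching_perm PR) in okR.
rewrite short_path_matching_cons in okR.
have vR := vP; rewrite (perm_mem (perm_flatten PR)) /= mem_cat negb_or in vR.
case/andP: vR => vs vR.
have noaug (Q : seq (seq T)) :
    pm_order (s :: R) < pm_order Q -> ~~ short_path_matching Q.
  by move=> lt; apply/negP => /maxP; rewrite ordP leqNgt lt.
clearbody R; clear maxP ordP okP wP PR.
case: s => [|a [|b [|c [|//]]]] in sP ws okR vs noaug *; first by [].
- by [].
- move: okR ws vs; rewrite /= !inE !negb_or !andbT -!andbA.
  case/and5P=> eab ab aR bR okR /orP[] /eqP ? /andP[va vb]; subst.
  + have := noaug ([:: v; a; b] :: R).
    rewrite short_path_matching_cons /= !inE /= evw eab !negb_or.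
    rewrite vw vb ab vR aR bR okR.
    by rewrite /pm_order /= ltnS leqnn => /(_ isT).
  + have := noaug ([:: a; b; v] :: R).
    rewrite short_path_matching_cons /= !inE /= ewv eab !negb_or.
    rewrite wv (eq_sym a v) va ab vR aR bR okR.
    by rewrite /pm_order /= ltnS leqnn => /(_ isT).
- move: okR ws vs; rewrite /= !inE !negb_or !andbT -!andbA.
  case/and5P=> eab ebc ab ac /and5P[bc aR bR cR okR].
  case/or3P=> /eqP ? /and3P[va vb vc]; subst.
  + have := noaug ([:: v; a] :: [:: b; c] :: R).
    rewrite !short_path_matching_cons /= !inE /= evw ebc !negb_or.
    rewrite vw vb vc ab ac bc vR aR bR cR okR.
    by rewrite /pm_order /= ltnS leqnn => /(_ isT).
  + by exists a, c.
  + have := noaug ([:: v; c] :: [:: a; b] :: R).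
    rewrite !short_path_matching_cons /= !inE /= evw eab !negb_or.
    rewrite vw va vb (eq_sym c a) (eq_sym c b) ab ac bc vR aR bR cR okR.
    by rewrite /pm_order /= ltnS leqnn => /(_ isT).
Qed.

Definition non_isolated (S : {set T}) : {set T} :=
  [set x | (x \notin S) && [exists y, (y \notin S) && e x y]].

Lemma path_matching_lower_bound : exists (P : seq (seq T)) (S : {set T}),
  path_matching e P /\ 3 * #|S| + #|non_isolated S| <= pm_order P.
Proof.
have [P0 [ok0 max0]] := max_short_path_matching.
pose reach := exchange_reach P0.
have max Q : reach Q ->
    forall Q', short_path_matching Q' -> pm_order Q' <= pm_order Q.
  by move=> /(exchange_reach_ok ok0)[_ ->].
pose D := [set v | `[< exists2 Q, reach Q & v \notin flatten Q >]].
pose S := [set w | [exists v in D, e v w]].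
have inD Q v : reach Q -> v \notin flatten Q -> v \in D.
  by move=> rQ vQ; rewrite inE; apply/asboolP; exists Q.
(* Exchanges never change a middle, so a path with middle [w] descends from one of [P0]. An original
   end is either still in place or was displaced at some stage, and a displaced end is uncovered at
   that moment. *)
have leaves Q : reach Q -> forall a w b, [:: a; w; b] \in Q ->
    exists a0 b0, [:: a0; w; b0] \in P0 /\
      {in [:: a0; b0], forall x, x \in [:: a; b] \/ x \in D}.
  elim=> [a w b ?|Q1 Q2 _ IH PQ a w b|a1 w1 b1 R _ IH a w b|].
  - by exists a, b; split=> // x; left.
  - by rewrite -(perm_mem PQ) => /IH.
  - rewrite inE => /orP[/eqP[-> -> ->]|wR].
      have [a0 [b0 [P0w ab0]]] := IH a1 w1 b1 (mem_head _ _).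
      by exists a0, b0; split=> // x /ab0; rewrite !inE orbC.
    by apply: IH; rewrite inE wR orbT.
  - move=> v a1 w1 b1 R rR IH evw vR a w b.
    rewrite inE => /orP[/eqP[-> -> ->]|wR]; last first.
      by apply: IH; rewrite inE wR orbT.
    have [a0 [b0 [P0w ab0]]] := IH a1 w1 b1 (mem_head _ _).
    exists a0, b0; split=> // x /ab0; rewrite !in_cons in_nil !orbF.
    case=> [/orP[/eqP->|->]|]; rewrite ?orbT; [right|by left|by right].
    have [okR _] := exchange_reach_ok ok0 rR.
    have [_ a1P] := short_path_matching_swap okR evw vR.
    exact: inD (exchange_swap rR evw vR) a1P.
have SP w : w \in S ->
    exists a b, [/\ [:: a; w; b] \in P0, a \in D & b \in D].
  rewrite inE => /existsP[v /andP[+ evw]].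
  rewrite inE => /asboolP[Q rQ vQ].
  have [okQ _] := exchange_reach_ok ok0 rQ.
  have [a [b abQ]] := uncovered_neighbor okQ (max Q rQ) vQ evw.
  have [a0 [b0 [P0w ab0]]] := leaves Q rQ _ _ _ abQ.
  (* Exchanging [v] with [a] or, after a reversal, with [b] uncovers either end of the current path;
     [leaves] then carries this over to the ends in [P0]. *)
  have PR := perm_to_rem abQ; set R := rem _ Q in PR.
  have vR := vQ; rewrite (perm_mem (perm_flatten PR)) in vR.
  have rR := exchange_perm rQ PR.
  have [okR _] := exchange_reach_ok ok0 rR.
  have [_ aR] := short_path_matching_swap okR evw vR.
  have aD := inD _ _ (exchange_swap rR evw vR) aR.
  have rR' := exchange_rev rR.
  have [okR' _] := exchange_reach_ok ok0 rR'.
  have vR' : v \notin flatten ([:: b; w; a] :: R).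
    by move: vR; rewrite /= !inE !negb_or => /and4P[-> -> ->].
  have [_ bR] := short_path_matching_swap okR' evw vR'.
  have bD := inD _ _ (exchange_swap rR' evw vR') bR.
  have DP x : x \in [:: a0; b0] -> x \in D.
    by case/ab0=> //; rewrite !in_cons in_nil orbF => /orP[]/eqP->.
  by exists a0, b0; rewrite !DP // !inE eqxx ?orbT.
exists P0, S; case/andP: (ok0) => pm0 _; split=> //.
set B := non_isolated S.
(* The vertices on [P1] and the uncovered vertices [U] are disjoint parts of [S :|: D], which is
   therefore large. *)
pose P1 := [seq s <- P0 | all (mem (S :|: D)) s & size s == 3].
have uP0 : uniq (flatten P0) by case/and3P: pm0.
pose U := [seq x <- enum T | x \notin flatten P0].
have P1sub x : x \in flatten P1 -> x \in flatten P0.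
  case/flattenP=> s; rewrite mem_filter => /andP[_ sP] xs.
  by apply/flattenP; exists s.
have uP1 : uniq (flatten P1).
  apply: subseq_uniq uP0; rewrite /P1; elim: (P0) => //= s P IH.
  case: ifP => _ /=; first exact: cat_subseq.
  exact: subseq_trans IH (suffix_subseq _ _).
have uU : uniq (U ++ flatten P1).
  rewrite cat_uniq filter_uniq ?enum_uniq // uP1 andbT.
  by apply/hasPn => x /P1sub xP; rewrite mem_filter negb_and negbK xP.
have szP1 : size (flatten P1) = 3 * size P1.
  rewrite /P1; elim: (P0) => //= s P IH.
  by case: ifP => //= /andP[_ /eqP s3]; rewrite size_cat IH s3 mulnS.
have leS : #|S| <= size P1.
  (* Reading off the entry at index 1, the middle, sends [P1] onto a list containing all of [S]. *)
  rewrite cardE -(size_map Some) -(size_map (fun s => onth s 1)).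
  apply: uniq_leq_size; first by rewrite map_inj_uniq ?enum_uniq // => x y [].
  move=> _ /mapP[w + ->]; rewrite mem_enum => wS.
  have [a [b [abP aD bD]]] := SP w wS.
  apply/mapP; exists [:: a; w; b] => //.
  by rewrite mem_filter abP /= !in_setU aD bD wS !orbT.
have szU : size U + pm_order P0 = #|T|.
  rewrite /U size_filter /pm_order -(card_uniqP uP0) cardE size_filter.
  by rewrite -enumT cardE addnC -[RHS](count_predC (mem (flatten P0))).
have leSD : size U + 3 * #|S| <= #|S :|: D|.
  apply: (@leq_trans (size (U ++ flatten P1))).
    by rewrite size_cat szP1 leq_add2l leq_mul2l leS.
  rewrite cardE; apply: uniq_leq_size => // x.
  rewrite mem_cat mem_enum in_setU mem_filter => /orP[/andP[xP _]|].
    by rewrite (inD P0) ?orbT //; exact: exchange_refl.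
  case/flattenP=> s; rewrite mem_filter => /andP[/andP[/allP sSD _] _] /sSD.
  by rewrite /= in_setU.
(* A vertex of [D] has all its neighbors in [S], hence is isolated once [S] is removed. *)
have dis : [disjoint B & S :|: D].
  rewrite disjoints_subset; apply/subsetP => x.
  rewrite in_setC in_setU negb_or inE => /andP[-> /existsP[y /andP[yS exy]]] /=.
  by apply: contra yS => xD; rewrite inE; apply/existsP; exists x; rewrite xD.
rewrite -(leq_add2l (size U)) szU addnA.
apply: (leq_trans (leq_add leSD (leqnn #|B|))).
by rewrite -cardsUI (disjoint_setI0 _) 1?disjoint_sym // cards0 addn0 max_card.
Qed.

End ShortPathMatching.

(* The blocks through a vertex of minimum degree [d] cover [A], so that
   [#|A| <= d * k] and [d * #|A| <= \sum_i #|B i|]. *)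
Lemma clique_cover_bound (I T : finType) (A : {set T})
    (B : I -> {set T}) (k : nat) :
  #|A| != 1 -> (forall i, #|B i| <= k) ->
  (forall x y, x \in A -> y \in A -> x != y ->
    exists2 i, x \in B i & y \in B i) ->
  3 * #|A| <= 2 * k + \sum_i #|B i|.
Proof.
move=> A1 Bk cov.
have [->|[x0 x0A]] := set_0Vmem A; first by rewrite cards0 muln0.
pose deg x := #|[set i | x \in B i]|.
case: (arg_minnP deg x0A) => v vA deg_min.
have degB : deg v * #|A| <= \sum_i #|B i|.
  have -> : \sum_i #|B i| = \sum_x deg x.
    under eq_bigr => i _ do rewrite -sum1_card big_mkcond.
    rewrite exchange_big; apply: eq_bigr => x _.
    by rewrite -big_mkcond /deg -sum1_card; apply: eq_bigl => i; rewrite inE.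
  rewrite mulnC -sum_nat_const big_mkcond; apply: leq_sum => x _.
  by case: ifP => // /deg_min.
(* A second vertex of [A] is what forces [v] itself into some block. *)
have [y yA vy] : exists2 y, y \in A & v != y.
  apply/exists_inP; apply: contraR A1 => /exists_inPn Av.
  apply/cards1P; exists v; apply/setP => y; rewrite inE.
  apply/idP/eqP => [/Av|->] //; by rewrite negbK => /eqP.
have degA : #|A| <= deg v * k.
  have /subset_leq_card/leq_trans : A \subset \bigcup_(i | v \in B i) B i.
    apply/subsetP => z zA; apply/bigcupP; have [<-|vz] := eqVneq v z.
      by have [i vi yi] := cov v y vA yA vy; exists i.
    by have [i vi zi] := cov v z vA zA vz; exists i.
  apply; apply: (@leq_trans (\sum_(i | v \in B i) #|B i|)).
    elim/big_rec2: _ => [|i m C _ IH]; first by rewrite cards0.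
    by rewrite (leq_trans (leq_card_setU _ _).1) // leq_add2l.
  rewrite /deg -sum_nat_const [leqRHS](eq_bigl (fun i => v \in B i)).
    exact: leq_sum.
  by move=> i; rewrite inE.
(* Degree 0 makes [A] empty. For degrees 1 and 2, add [degB] to, respectively, twice [degA] and
   [degA] itself. From degree 3 on, [degB] alone suffices. *)
move: degA degB; case: (deg v) => [|[|[|d]]]; nia.
Qed.

(** * Combining the color classes *)

Lemma color_graph_sym (r n : nat) (c : coloring r n) (i : 'I_r) :
  symmetric (color_graph c i).
Proof. by move=> x y; rewrite /color_graph eq_sym setUC. Qed.

Lemma color_graph_irr (r n : nat) (c : coloring r n) (i : 'I_r) :
  irreflexive (color_graph c i).
Proof. by move=> x; rewrite /color_graph eqxx. Qed.

(** The sizes of the [B i] cancel when the clique cover bound, applied to the vertices outside every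
    [S i], is added to the sum of the color inequalities; integrality of these contributes the term
    [r]. *)
Lemma avoidable_bound (r n k : nat) (p : 'I_r -> nat) :
  2 <= k -> (forall i, p i <= k) -> ~ PM_unavoidable p n ->
  3 * n + r < 2 * k + \sum_i p i.
Proof.
move=> k2 pk /existsNP[c /forallNP nPM].
pose B i (S : {set 'I_n}) : {set 'I_n} := non_isolated (color_graph c i) S.
have /fin_all_exists[S S_p] i :
    exists S : {set 'I_n}, 3 * #|S| + #|B i S| < p i.
  have [P [S [okP leP]]] :=
    path_matching_lower_bound (color_graph_sym c i) (color_graph_irr c i).
  exists S; apply: leq_ltn_trans leP _; rewrite ltnNge; apply/negP => pP.
  by apply: (nPM i); exists P.
pose A := ~: \bigcup_i S i.
have inA x i : x \in A -> x \notin S i.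
  by rewrite inE; apply: contra => xS; apply/bigcupP; exists i.
have cov x y : x \in A -> y \in A -> x != y ->
    exists2 i, x \in B i (S i) & y \in B i (S i).
  move=> xA yA xy; exists (c [set x; y]); rewrite inE inA //=; apply/existsP.
    by exists y; rewrite inA //= /color_graph xy eqxx.
  by exists x; rewrite inA //= color_graph_sym /color_graph xy eqxx.
have sumSB : 3 * \sum_i #|S i| + \sum_i #|B i (S i)| + r <= \sum_i p i.
  apply: (@leq_trans (\sum_i (3 * #|S i| + #|B i (S i)| + 1))).
    by rewrite big_distrr !big_split /= sum1_card card_ord.
  by apply: leq_sum => i _; rewrite addn1.
have nA : n <= \sum_i #|S i| + #|A|.
  rewrite -[n in leqLHS]card_ord -(cardsC (\bigcup_i S i)) leq_add2r.
  elim/big_rec2: _ => [|i m C _ IH]; first by rewrite cards0.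
  by rewrite (leq_trans (leq_card_setU _ _).1) // leq_add2l.
(* The clique cover bound excludes a single vertex; that case adds only 3 to the left side, and
   [3 < 2 * k]. *)
have [A1|A1] := eqVneq #|A| 1; first lia.
have Bk i : #|B i (S i)| <= k.-1 by have := S_p i; have := pk i; lia.
by have := clique_cover_bound A1 Bk cov; lia.
Qed.

Local Open Scope ring_scope.

Theorem theorem1p3 (r : nat) (r_ge2 : (2 <= r)%N) (p : 'I_r -> nat)
  (p_noninc : forall i j : 'I_r, (i <= j)%N -> (p j <= p i)%N)
  (p_ge2 : forall i : 'I_r, (2 <= p i)%N) :
  (RPM p)%:Z <= Num.ceil ((p (Ordinal (ltnW r_ge2)))%:R - r%:R / 3%:R
    + \sum_(i < r | (0 < i)%N) (p i)%:R / 3%:R :> rat).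
Proof.
set o := Ordinal _.
(* Divided by 3, this puts [(RPM p).-1] strictly below the rational under the ceiling, so its
   successor is at most the ceiling. *)
suff lt3 : (3 * (RPM p).-1 + r < 2 * p o + \sum_i p i)%N.
  have RPM_gt0 : (0 < RPM p)%N.
    by rewrite /RPM; case: ex_minnP => m /asboolP[].
  move: lt3; rewrite (bigD1 o) //= => lt3.
  rewrite (eq_bigl (fun i => i != o)) => [|i]; last by rewrite -lt0n.
  rewrite -mulr_suml -natr_sum -(prednK RPM_gt0) intS addrC lezD1 ceil_gt_int.
  set s := (\sum_(i | _) _)%N in lt3 *; clearbody s.
  have : (3 * (RPM p).-1%:R + r%:R < 3 * (p o)%:R + s%:R :> rat).
    by rewrite -!natrM -!natrD ltr_nat; lia.
  lra.
rewrite /RPM; case: ex_minnP => N /asboolP[N_gt0 _] min_N.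
case: N N_gt0 min_N => // m _ min_m.
(* [RPM] is a minimum over positive [n], so minimality says nothing about [m = 0]; there positivity
   of every [p i] is enough. *)
have [->|m_gt0] := posnP m.
  rewrite muln0 add0n; apply: (@leq_trans (2 * p o + r)%N).
    by rewrite -[ltnLHS]add0n ltn_add2r muln_gt0 (leq_trans _ (p_ge2 o)).
  rewrite leq_add2l -[leqLHS]card_ord -sum1_card; apply: leq_sum => i _.
  exact: ltnW.
apply: avoidable_bound => // [i|unav]; first exact: p_noninc.
suff: (m < m)%N by rewrite ltnn.
by apply: min_m; apply/asboolP.
Qed.
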